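(* Let $n$ be a positive odd integer. Then $$\sum_{k=0}^{n-1}\frac{(q^2;q^4)_k(-q;q^2)_k^2}{(q^4;q^4)_k(-q^4;q^4)_k^2}[6k+1]q^{k^2} \equiv 0\pmod{[n]}$$ and $$\sum_{k=0}^{(n-1)/2}\frac{(q^2;q^4)_k(-q;q^2)_k^2}{(q^4;q^4)_k(-q^4;q^4)_k^2}[6k+1]q^{k^2} \equiv 0\pmod{[n]}.$$
   Context: Here $q$ is an indeterminate, $(x;y)_k=\prod_{j=0}^{k-1}(1-xy^j)$ (with $(x;y)_0=1$), and $[k]=\frac{1-q^k}{1-q}$. For rational functions $A(q),B(q)\in\mathbb Z(q)$ and a polynomial $P(q)\in\mathbb Z[q]$, the congruence $A(q)\equiv B(q)\pmod{P(q)}$ means that $A(q)-B(q)=A_1(q)/A_2(q)$ with $A_1,A_2\in\mathbb Z[q]$, where $P$ divides $A_1$ and $P$ is coprime with $A_2$. *)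

(* Defs.v *)
From HB Require Import structures.
From mathcomp Require Import all_boot all_order all_algebra.

Set Implicit Arguments.
Unset Strict Implicit.
Unset Printing Implicit Defensive.

Import GRing.Theory.
Local Open Scope ring_scope.

Notation Zq := {poly int}.
(* Z(q), as the fraction field of Z[q]. *)
Notation ratfun := {fraction {poly int}}.

Notation "x %:F" := (tofrac x) : ring_scope.

Definition qvar : ratfun := 'X%:F.

Definition qpoch (R : comNzRingType) (x y : R) (k : nat) : R :=
  \prod_(j < k) (1 - x * y ^+ j).

Definition qint (k : nat) : ratfun := (1 - qvar ^+ k) / (1 - qvar).

(* The element of Z[q] whose image in Z(q) is qint k, see qint_polyE; needed
   because the modulus of a congruence is a polynomial. *)
Definition qint_poly (k : nat) : Zq := \sum_(i < k) 'X^i.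

Lemma qint_polyE k : (qint_poly k)%:F = qint k.
Proof.
have nz : 1 - qvar != 0.
  rewrite subr_eq0 -tofrac1 tofrac_eq; apply/eqP => /(congr1 (fun p : {poly int} => size p)).
  by rewrite size_poly1 size_polyX.
apply: (mulIf nz); rewrite /qint divfK // /qvar -tofracXn -tofrac1 -!tofracB.
rewrite -tofracM; congr (_%:F); rewrite /qint_poly.
by rewrite -[RHS]opprB subrX1 mulrC -mulNr opprB.
Qed.

(* Divisibility and coprimality in the ring Z[q] itself. The library's %| and
   coprimep on {poly int} are defined by pseudo-division, hence only up to
   nonzero integer constants, i.e. they are the notions of Q[q]. *)
Definition Zq_dvd (P A : Zq) : Prop := exists C : Zq, A = C * P.

Definition Zq_coprime (P A : Zq) : Prop :=
  forall D : Zq, Zq_dvd D P -> Zq_dvd D A -> D \is a GRing.unit.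

(* A2 != 0 is explicit because division by 0 is total, and 0 is coprime to 1. *)
Definition ratfun_congr (A B : ratfun) (P : Zq) : Prop :=
  exists A1 A2 : Zq,
    [/\ A2 != 0, A - B = A1%:F / A2%:F, Zq_dvd P A1 & Zq_coprime P A2].

Definition summand (k : nat) : ratfun :=
  let q := qvar in
  qpoch (q ^+ 2) (q ^+ 4) k * qpoch (- q) (q ^+ 2) k ^+ 2
  / (qpoch (q ^+ 4) (q ^+ 4) k * qpoch (- q ^+ 4) (q ^+ 4) k ^+ 2)
  * qint (6 * k + 1) * q ^+ (k ^ 2).

(* Main.v *)
Require Import Defs.
From HB Require Import structures.
From mathcomp Require Import all_boot all_order all_algebra all_field.
From mathcomp Require Import ring zify.

(** Write $S_k$ for the $k$-th summand. The polynomial $[n]$ is monic and its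
    complex roots are the $n$-th roots of unity other than $1$, each simple; so
    a fraction whose denominator vanishes at none of them is divisible by $[n]$
    as soon as it vanishes at all of them ([qint_poly_dvd],
    [qint_poly_coprime]). The quotient $(q^2;q^4)_k/(q^4;q^4)_k$ hides a
    central $q$-binomial coefficient in base $q^2$, divided by $(-q^2;q^2)_k^2$
    ([central_qbinom]); hence $S_k$ has a denominator made of factors
    $1+q^j$ only, none of which vanishes at a root of unity of odd order. The
    congruences therefore say that the two sums vanish at every primitive
    $d$-th root of unity $\zeta$, where $d > 1$ divides $n$.

    At such a $\zeta$ everything is periodic except the $q$-binomial, to which
    the $q$-Lucas theorem applies: $S_{ld+k} = C_l S_k$ for $0 \le k < d$, with
    $C_l$ independent of $k$. Moreover $S_k = 0$ for $d/2 < k < d$. Both sums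
    are thus combinations of copies of the single sum
    $S_0 + \dots + S_{(d-1)/2}$, and it remains to see that this one is zero
    ([sum_half_period]).

    For that, the factor $q$ of $1-q^{6k+1} = 1 - q\,q^{6k}$ is freed into a
    variable $a$, and $-q$ into a parameter $b$, as in the quadratic summation
    of Gasper and Rahman with the two remaining parameters specialized.
    With $d = 2m+1$, the sum
    $$f(a) = \sum_{k=0}^{m} (1-aq^{6k})\, a^k q^{k^2-k}
       \frac{(b,q^2/b;q^2)_k\,(q^2;q^4)_k}{(q^4;q^4)_k}
       \prod_{j=k}^{m-1}(1-aq^{4j+4}/b)(1-abq^{4j+2})$$
    is a polynomial in $a$ of degree at most $d$. At a primitive $d$-th root of
    unity $q$ the difference $f(aq^4) - f(a)$ telescopes to $0$
    ([cleared_sum_qshift]), so that only the coefficients of $a^0$ and $a^d$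
    survive. These are $1$ and $-1$, whence $f(a) = 1 - a^d$
    ([cleared_sum_root_of_unity]), and $f(q) = 0$. *)

Set Implicit Arguments.
Unset Strict Implicit.
Unset Printing Implicit Defensive.

Import GRing.Theory.
Local Open Scope ring_scope.

(** * Shifted factorials and polynomial degrees *)

Lemma qpoch0 (R : comNzRingType) (x y : R) : qpoch x y 0 = 1.
Proof. by rewrite /qpoch big_ord0. Qed.

Lemma qpochS (R : comNzRingType) (x y : R) k :
  qpoch x y k.+1 = qpoch x y k * (1 - x * y ^+ k).
Proof. by rewrite /qpoch big_ord_recr. Qed.

Lemma rmorph_qpoch (R S : comNzRingType) (f : {rmorphism R -> S}) (x y : R) k :
  f (qpoch x y k) = qpoch (f x) (f y) k.
Proof.
rewrite /qpoch rmorph_prod; apply: eq_bigr => j _.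
by rewrite rmorphB rmorphM rmorphXn rmorph1.
Qed.

Lemma qpochD (R : comNzRingType) (x y : R) m k :
  qpoch x y (m + k) = qpoch x y m * qpoch (x * y ^+ m) y k.
Proof.
elim: k => [|k IH]; first by rewrite addn0 qpoch0 mulr1.
by rewrite addnS !qpochS IH exprD; ring.
Qed.

Lemma qpoch_periodic (R : comNzRingType) (x y : R) d l k : y ^+ d = 1 ->
  qpoch x y (l * d + k) = qpoch x y d ^+ l * qpoch x y k.
Proof.
move=> yd; elim: l => [|l IH]; first by rewrite mul1r.
by rewrite mulSn -addnA qpochD yd mulr1 IH exprS mulrA.
Qed.

Lemma qpoch_even (R : comNzRingType) (x : R) k :
  qpoch x x (2 * k) = qpoch x (x ^+ 2) k * qpoch (x ^+ 2) (x ^+ 2) k.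
Proof.
elim: k => [|k IH]; first by rewrite muln0 !qpoch0 mulr1.
by rewrite mulnS add2n !qpochS IH (exprS x (2 * k)) !(exprM x 2 k); ring.
Qed.

Lemma qpoch_sqr (R : comNzRingType) (x : R) k :
  qpoch (x ^+ 2) (x ^+ 2) k = qpoch x x k * qpoch (- x) x k.
Proof.
elim: k => [|k IH]; first by rewrite !qpoch0 mulr1.
by rewrite !qpochS IH -exprM mulnC exprM; ring.
Qed.

Lemma qpoch_neq0 (R : idomainType) (x y : R) k :
  (forall j, (j < k)%N -> 1 - x * y ^+ j != 0) -> qpoch x y k != 0.
Proof. by move=> H; apply/prodf_neq0 => j _; apply: H. Qed.

Lemma size_mul_le (R : comNzRingType) (e f : nat) (p r : {poly R}) :
  (size p <= e.+1)%N -> (size r <= f.+1)%N -> (size (p * r)%R <= (e + f).+1)%N.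
Proof. by move=> sp sr; apply: leq_trans (size_polyMleq _ _) _; lia. Qed.

Lemma coefM_top (R : comNzRingType) (e f : nat) (p r : {poly R}) :
  (size p <= e.+1)%N -> (size r <= f.+1)%N -> (p * r)`_(e + f) = p`_e * r`_f.
Proof.
move=> sp sr; have le : (e < (e + f).+1)%N by rewrite ltnS leq_addr.
rewrite coefM (bigD1 (Ordinal le)) //= addKn big1 ?addr0 // => j /eqP nj.
have {}nj : (j : nat) != e by apply/eqP => je; apply: nj; apply: val_inj.
have [lt|ge] := ltnP e j.
  by rewrite nth_default ?mul0r //; apply: leq_trans sp lt.
have {nj ge} lt : (j < e)%N by rewrite ltn_neqAle nj.
have -> : r`_(e + f - j) = 0; last by rewrite mulr0.
by apply/nth_default/(leq_trans sr); rewrite ltn_subRL ltn_add2r.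
Qed.

Lemma size_one_sub_X (R : comNzRingType) (x : R) : (size (1 - x *: 'X)%R <= 2)%N.
Proof.
apply: leq_trans (size_polyD _ _) _; rewrite size_polyN geq_max size_poly1 /=.
by apply: leq_trans (size_scale_leq _ _) _; rewrite size_polyX.
Qed.

Lemma coef_one_sub_X (R : comNzRingType) (x : R) : (1 - x *: 'X)`_1 = - x.
Proof. by rewrite coefB coef1 coefZ coefX /= sub0r mulr1. Qed.

Lemma coef_comp_scaleX (R : comNzRingType) (c : R) (p : {poly R}) i :
  (p \Po (c *: 'X))`_i = c ^+ i * p`_i.
Proof.
have exprZX j : (c *: 'X) ^+ j = c ^+ j *: 'X^j by rewrite exprZn.
rewrite coef_comp_poly.
under eq_bigr => j _ do rewrite exprZX coefZ coefXn.
have [lt|ge] := ltnP i (size p).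
  rewrite (bigD1 (Ordinal lt)) //= eqxx mulr1 big1 ?addr0 1?mulrC // => j ne.
  by rewrite -val_eqE /= eq_sym in ne; rewrite (negPf ne) !mulr0.
rewrite nth_default // mulr0 big1 // => j _.
by rewrite eqn_leq [(i <= j)%N]leqNgt (leq_trans (ltn_ord j) ge) !mulr0.
Qed.

(** * A summation at roots of unity *)

(** The rational function identity behind the telescoping of
    [cleared_sum_qshift], with $K = q^{2k}$, $A = a^k$, $u = U_k$, and $P$ the
    product of the later factors. The certificate is the polynomial $1 + aK$;
    once $c = 1/b$ is used to remove the products $bc$, both sides become
    polynomials of degree at most $1$ in $b$ and $c$, and they coincide. *)
Lemma telescoping_certificate (R : comNzRingType) (a b c q K A u P : R) :
  b * c = 1 ->
  let w := (1 - a * c * (K ^+ 2 * q ^+ 4)) * (1 - a * b * (K ^+ 2 * q ^+ 2)) in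
  (1 - a * c * q ^+ 2) * (1 - a * b) *
    ((1 - a * q ^+ 4 * K ^+ 3) * (A * K ^+ 2) * u * P) -
  (1 - a * K ^+ 3) * A * u * (w * P) =
  (1 + a * (K * q ^+ 2)) * (a * A) * P *
    ((1 - b * K) * (1 - c * (K * q ^+ 2)) * (1 - K ^+ 2 * q ^+ 2) * K * u) -
  (1 - K ^+ 2) * (1 + a * K) * A * u * (w * P).
Proof.
move=> bc1 /=.
have bcE X Y : (1 - c * X) * (1 - b * Y) = 1 - c * X - b * Y + X * Y.
  have -> : X * Y = b * c * (X * Y) by rewrite bc1 mul1r.
  ring.
have E2 : (1 - a * c * q ^+ 2) * (1 - a * b) =
    1 - c * (a * q ^+ 2) - b * a + a * q ^+ 2 * a.
  by rewrite -bcE; ring.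
have E3 X Y : (1 - a * c * X) * (1 - a * b * Y) =
    1 - c * (a * X) - b * (a * Y) + a * X * (a * Y).
  by rewrite -bcE; ring.
have E4 X Y : (1 - b * X) * (1 - c * Y) = 1 - c * Y - b * X + Y * X.
  by rewrite -bcE mulrC.
by rewrite E2 E3 E4; ring.
Qed.

(** The sum over $k \le m$ of
    $(1-aq^{6k})a^kU_k/((acq^4;q^4)_k(abq^2;q^4)_k)$, multiplied by the last
    denominator so that it is polynomial in $a$. Here $c$ stands for $1/b$: it
    is a separate argument because the sum is also used in the polynomial ring
    over the field of $b$. *)
Definition cleared_sum (R : comNzRingType) (q b c : R) (U : nat -> R)
    (m : nat) (a : R) : R :=
  \sum_(0 <= k < m.+1) (1 - a * q ^+ (6 * k)) * a ^+ k * U k *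
    \prod_(k <= j < m)
      ((1 - a * c * q ^+ (4 * j + 4)) * (1 - a * b * q ^+ (4 * j + 2))).

(** Replacing $a$ by $aq^4$ shifts the product of the factors
    $w_j = (1-acq^{4j+4})(1-abq^{4j+2})$ by one index, and
    $w_m = (1-acq^2)(1-ab)$ because $q^{4m+2} = 1$. Both sums, multiplied by
    $w_m$, thus have their $k$-th terms divisible by $w_{k+1} \cdots w_m$, and
    their difference telescopes.
    The boundary term at $k = 0$ contains $1-q^0$, the one at $k = m+1$
    contains $1-q^{4m+2}$, by way of the recurrence of $U$. *)
Lemma cleared_sum_qshift (R : comNzRingType) (q b c : R) (U : nat -> R) (m : nat) (a : R) :
  b * c = 1 -> q ^+ (4 * m + 2) = 1 ->
  (forall k, (k <= m)%N -> (1 - q ^+ (4 * k + 4)) * U k.+1 =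
     (1 - b * q ^+ (2 * k)) * (1 - c * q ^+ (2 * k + 2)) *
     (1 - q ^+ (4 * k + 2)) * q ^+ (2 * k) * U k) ->
  (1 - a * c * q ^+ 2) * (1 - a * b) *
    (cleared_sum q b c U m (a * q ^+ 4) - cleared_sum q b c U m a) = 0.
Proof.
move=> bc1 qm UE.
pose w j : R := (1 - a * c * q ^+ (4 * j + 4)) * (1 - a * b * q ^+ (4 * j + 2)).
have wm : w m = (1 - a * c * q ^+ 2) * (1 - a * b).
  have e : (4 * m + 4 = 4 * m + 2 + 2)%N by rewrite -addnA.
  by rewrite /w e exprD qm mul1r mulr1.
(* The antidifference; $1 + aq^{2k}$ is the certificate. *)
pose H k : R := (1 - q ^+ (4 * k)) * (1 + a * q ^+ (2 * k)) * a ^+ k * U k *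
  \prod_(k <= j < m.+1) w j.
have H0 : H 0 = 0 by rewrite /H muln0 expr0 subrr !mul0r.
have Hm : H m.+1 = 0.
  have -> : H m.+1 = ((1 - q ^+ (4 * m + 4)) * U m.+1) *
      ((1 + a * q ^+ (2 * m.+1)) * a ^+ m.+1 * \prod_(m.+1 <= j < m.+1) w j).
    by rewrite /H mulnS addnC; ring.
  by rewrite UE // qm subrr mulr0 !mul0r.
transitivity (\sum_(0 <= k < m.+1) (H k.+1 - H k)); last first.
  by rewrite telescope_sumr // Hm H0 subrr.
rewrite -wm /cleared_sum -sumrB mulr_sumr.
apply: eq_big_nat => k km.
have W1 : \prod_(k <= j < m.+1) w j = w k * \prod_(k.+1 <= j < m.+1) w j by rewrite big_ltn.
have W2 : \prod_(k <= j < m) ((1 - a * q ^+ 4 * c * q ^+ (4 * j + 4)) *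
    (1 - a * q ^+ 4 * b * q ^+ (4 * j + 2))) = \prod_(k.+1 <= j < m.+1) w j.
  rewrite big_add1 /=; apply: eq_bigr => j _; rewrite /w mulnS.
  by rewrite -addnA !exprD; ring.
have W3 : w m * \prod_(k <= j < m) w j = \prod_(k <= j < m.+1) w j.
  by rewrite big_nat_recr //= mulrC.
rewrite W2 mulrBr (mulrC (w m) (_ * \prod_(k <= j < m) _)) -(mulrA _ _ (w m)).
rewrite (mulrC _ (w m)) [w m * \prod_(k <= j < m) _]W3 W1 /H W1.
set P := \prod_(_ <= _ < _) _.
have E1 : (1 - q ^+ (4 * k.+1)) * (1 + a * q ^+ (2 * k.+1)) * a ^+ k.+1 * U k.+1 * P =
  (1 + a * q ^+ (2 * k.+1)) * a ^+ k.+1 * P * ((1 - b * q ^+ (2 * k)) * (1 - c * q ^+ (2 * k + 2)) *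
     (1 - q ^+ (4 * k + 2)) * q ^+ (2 * k) * U k).
  by rewrite -UE // mulnS [(4 + _)%N]addnC; ring.
rewrite {}E1 wm /w; move: P (U k) => P u.
have -> : (2 * k.+1 = 2 * k + 2)%N by lia.
have -> : (4 * k = 2 * k * 2)%N by lia.
have -> : (6 * k = 2 * k * 3)%N by lia.
have -> : (a * q ^+ 4) ^+ k = a ^+ k * q ^+ (2 * k * 2).
  by rewrite exprMn -exprM; congr (_ * _ ^+ _); lia.
rewrite (exprS a k) !(exprD q (2 * k)) !(exprD q (2 * k * 2)) !(exprM q (2 * k)).
exact: telescoping_certificate.
Qed.

Lemma rmorph_cleared_sum (R S : comNzRingType) (f : {rmorphism R -> S})
    (q b c : R) (U : nat -> R) (m : nat) (a : R) :
  f (cleared_sum q b c U m a) = cleared_sum (f q) (f b) (f c) (f \o U) m (f a).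
Proof.
rewrite /cleared_sum rmorph_sum; apply: eq_bigr => k _.
rewrite !rmorphM rmorph_prod rmorphB rmorphM !rmorphXn rmorph1; congr (_ * _).
by apply: eq_bigr => j _; rewrite rmorphM !rmorphB !rmorphM !rmorphXn rmorph1.
Qed.

(** A polynomial $f$ of degree at most $d$ with $f(q^4a) = f(a)$ has the form
    $f_0 + f_da^d$, since $q^{4i} \ne 1$ for $0 < i < d$. The coefficient $f_d$
    comes from the term $k = 0$ alone, as the degree of the $k$-th term is at
    most $d - k$; it equals $-q^{6+14+\dots+(8m-2)} = -(q^{4m+2})^m = -1$. *)
Lemma cleared_sum_root_of_unity (F : fieldType) (q b : F) (U : nat -> F) m :
  (2 * m + 1).-primitive_root q -> b != 0 -> U 0 = 1 ->
  (forall k, (k <= m)%N -> (1 - q ^+ (4 * k + 4)) * U k.+1 =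
     (1 - b * q ^+ (2 * k)) * (1 - b^-1 * q ^+ (2 * k + 2)) *
     (1 - q ^+ (4 * k + 2)) * q ^+ (2 * k) * U k) ->
  forall a, cleared_sum q b b^-1 U m a = 1 - a ^+ (2 * m + 1).
Proof.
move=> qp b0 U0 UE a; set c := b^-1; have bc1 : b * c = 1 by rewrite mulfV.
set d := (2 * m + 1)%N in qp *.
have qd : q ^+ (4 * m + 2) = 1.
  by rewrite (_ : 4 * m + 2 = d * 2)%N ?exprM ?(prim_expr_order qp) ?expr1n // /d; lia.
pose f : {poly F} := cleared_sum q%:P b%:P c%:P (polyC \o U) m 'X.
(* The variable $a$ is made an indeterminate, to compare coefficients. *)
suff fE : f = 1 - 'X^d.
  have : f.[a] = 1 - a ^+ d by rewrite fE !hornerE.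
  rewrite -[f.[a]]/(horner_eval a f) rmorph_cleared_sum /= !horner_evalE !hornerE => <-.
  apply: eq_bigr => k _; rewrite /= horner_evalE hornerC; congr (_ * _).
have fq : f \Po (q ^+ 4 *: 'X) = f.
  have -> : f \Po (q ^+ 4 *: 'X) = cleared_sum q%:P b%:P c%:P (polyC \o U) m ('X * q%:P ^+ 4).
    rewrite -[LHS]/(comp_poly (q ^+ 4 *: 'X) f) rmorph_cleared_sum /= !comp_polyC comp_polyX.
    rewrite -mul_polyC mulrC rmorphXn.
    by apply: eq_bigr => k _; rewrite /= comp_polyC.
  (* The factor $w_m$ has constant coefficient $1$, hence it can be cancelled. *)
  have nz (x y : F) : 1 - 'X * x%:P * y%:P != 0.
    apply/eqP => /(congr1 (fun p : {poly F} => p.[0])); rewrite !hornerE subr0 => /eqP.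
    by rewrite oner_eq0.
  have := @cleared_sum_qshift _ q%:P b%:P c%:P (polyC \o U) m 'X.
  rewrite -!rmorphM bc1 -!rmorphXn /= qd => /(_ erefl erefl) H.
  apply/eqP; rewrite -subr_eq0; apply/eqP.
  have nz2 : (1 - 'X * c%:P * (q ^+ 2)%:P) * (1 - 'X * b%:P) != 0.
    by rewrite mulf_neq0 // -[b%:P]mulr1 mulrA nz.
  apply: (mulfI nz2); rewrite mulr0; apply: H => k km /=.
  by have := congr1 polyC (UE k km); rewrite !(polyCM, polyCB, polyC_exp, polyC1).
have fqi i : (q ^+ (4 * i) - 1) * f`_i = 0.
  have := coef_comp_scaleX (q ^+ 4) f i.
  by rewrite fq -exprM => e; rewrite mulrBl mul1r -e subrr.
pose w j : {poly F} := (1 - 'X * c%:P * q%:P ^+ (4 * j + 4)) *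
  (1 - 'X * b%:P * q%:P ^+ (4 * j + 2)).
pose t k : {poly F} := (1 - 'X * q%:P ^+ (6 * k)) * 'X^k * (U k)%:P *
  \prod_(k <= j < m) w j.
have fsum : f = \sum_(0 <= k < m.+1) t k by [].
have XC (x : F) : 'X * x%:P = x *: 'X by rewrite mulrC mul_polyC.
have wE j : w j =
    (1 - (c * q ^+ (4 * j + 4)) *: 'X) * (1 - (b * q ^+ (4 * j + 2)) *: 'X).
  by rewrite /w -!rmorphXn -!mulrA -!rmorphM !XC.
have w_size j : (size (w j) <= 3)%N.
  by rewrite wE; apply: (@size_mul_le _ 1 1); apply: size_one_sub_X.
have sw k i : (size (\prod_(k <= j < k + i) w j)%R <= (2 * i).+1)%N.
  elim: i => [|i IH]; first by rewrite addn0 big_geq // size_poly1.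
  rewrite addnS big_nat_recr ?leq_addr //= mulnS [(2 + _)%N]addnC.
  exact: size_mul_le IH (w_size _).
have st k : (k <= m)%N -> (size (t k) <= (1 + k + 0 + 2 * (m - k)).+1)%N.
  move=> km; rewrite /t -rmorphXn XC.
  apply: size_mul_le; last by have := sw k (m - k)%N; rewrite subnKC.
  apply: size_mul_le; last exact: size_polyC_leq1.
  apply: size_mul_le; last by rewrite size_polyXn.
  exact: size_one_sub_X.
have fd : f`_d = -1.
  rewrite fsum big_ltn // coefD coef_sum big1_seq ?addr0; last first.
    move=> k; rewrite mem_index_iota => /andP[_ /andP[k0 km]].
    rewrite nth_default //; apply: leq_trans (st k _) _ => //; rewrite /d; lia.
  have -> : d = (1 + 0 + 0 + 2 * m)%N by rewrite /d; lia.
  have tw i : (\prod_(0 <= j < i) w j)`_(2 * i) = q ^+ ((4 * i + 2) * i).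
    elim: i => [|i IH]; first by rewrite big_geq // coef1 muln0.
    rewrite big_nat_recr //= mulnS [(2 + _)%N]addnC coefM_top ?w_size //; last exact: (sw 0).
    rewrite IH wE (@coefM_top _ 1 1) ?size_one_sub_X // !coef_one_sub_X mulrNN.
    rewrite mulrACA [c * b]mulrC bc1 mul1r -!exprD; congr (_ ^+ _); lia.
  rewrite /t muln0 !expr0 !mulr1 U0 mulr1 -['X]scale1r.
  rewrite coefM_top ?size_one_sub_X ?coef_one_sub_X //; last exact: (sw 0).
  by rewrite tw exprM qd expr1n mulr1.
have f0 : f`_0 = 1.
  rewrite -horner_coef0 fsum horner_sum big_ltn // big1_seq ?addr0 => [|k].
    rewrite /t muln0 !expr0 mulr1 U0 !hornerE horner_prod subr0 mul1r big1 // => j _.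
    by rewrite /w !hornerE ?subr0 ?mulr1.
  rewrite andTb mem_index_iota => /andP[k0 _].
  by rewrite /t !hornerE expr0n eqn0Ngt k0 /= mulr0 !mul0r.
apply/polyP => i; rewrite coefB coef1 coefXn.
have [-> | i0] := eqVneq i 0%N.
  by rewrite f0 /d addn1 /= subr0.
rewrite sub0r.
have [-> | id] := eqVneq i d; first by rewrite fd.
rewrite oppr0.
have [di | di] := ltnP d i.
  rewrite fsum coef_sum big1_seq // => k.
  rewrite mem_index_iota => /andP[_ /andP[_ km]].
  rewrite nth_default //; apply: leq_trans (st k _) _ => //; move: di; rewrite /d; lia.
have /eqP := fqi i; rewrite mulf_eq0 => /orP[|/eqP //].
rewrite subr_eq0 -(prim_order_dvd qp) Gauss_dvdr.
  by move/dvdn_leq; rewrite lt0n i0 leqNgt ltn_neqAle id di => /(_ erefl).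
by rewrite -[4%N]/(2 ^ 2)%N coprimeXr // coprimen2 /d oddD oddM.
Qed.

(** * Gaussian binomial coefficients and the q-Lucas theorem *)

(** Defined by Pascal's rule, so that it makes sense at roots of unity, where
    the quotient of shifted factorials is $0/0$. *)
Fixpoint qbinom (R : comNzRingType) (x : R) (n m : nat) : R :=
  match n, m with
  | _, 0 => 1
  | 0, _.+1 => 0
  | n'.+1, m'.+1 => qbinom x n' m' + x ^+ m * qbinom x n' m
  end.

Lemma rmorph_qbinom (R S : comNzRingType) (f : {rmorphism R -> S}) (x : R) n m :
  f (qbinom x n m) = qbinom (f x) n m.
Proof.
elim: n m => [|n IH] [|m] /=; rewrite ?rmorph1 ?rmorph0 //.
by rewrite rmorphD rmorphM rmorphXn !IH.
Qed.

Lemma qbinom0 (R : comNzRingType) (x : R) n : qbinom x n 0 = 1.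
Proof. by case: n. Qed.

Lemma qbinomS (R : comNzRingType) (x : R) n m :
  qbinom x n.+1 m.+1 = qbinom x n m + x ^+ m.+1 * qbinom x n m.+1.
Proof. by []. Qed.

Lemma qbinom_small (R : comNzRingType) (x : R) n m : (n < m)%N -> qbinom x n m = 0.
Proof.
elim: n m => [|n IH] [|m] //= nm.
by rewrite !IH ?mulr0 ?addr0 // ltnW.
Qed.

Lemma qbinomn (R : comNzRingType) (x : R) n : qbinom x n n = 1.
Proof. by elim: n => //= n ->; rewrite qbinom_small // mulr0 addr0. Qed.

Lemma qbinom_qpoch (R : comNzRingType) (x : R) n m :
  qbinom x (n + m) m * (qpoch x x m * qpoch x x n) = qpoch x x (n + m).
Proof.
elim: n m => [|n IHn] m; first by rewrite qbinomn qpoch0 mulr1 mul1r.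
elim: m => [|m IHm]; first by rewrite addn0 qbinom0 qpoch0 !mul1r.
rewrite addnS qbinomS.
have -> : (qbinom x (n.+1 + m) m + x ^+ m.+1 * qbinom x (n.+1 + m) m.+1) *
    (qpoch x x m.+1 * qpoch x x n.+1) =
  (1 - x * x ^+ m) * (qbinom x (n.+1 + m) m * (qpoch x x m * qpoch x x n.+1)) +
  x * x ^+ m * (1 - x * x ^+ n) *
    (qbinom x (n + m.+1) m.+1 * (qpoch x x m.+1 * qpoch x x n)).
  by rewrite !qpochS addnS addSn exprS; ring.
rewrite IHm IHn addnS addSn !qpochS exprS exprD; ring.
Qed.

(** Both sides equal $(x;x)_{2k}/((x;x)_k(-x;x)_k)^2$, by splitting
    $(x;x)_{2k}$ into odd and even powers of $x$. *)
Lemma central_qbinom (F : fieldType) (x : F) k :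
  qpoch x x k != 0 -> qpoch (- x) x k != 0 ->
  qbinom x (2 * k) k / qpoch (- x) x k ^+ 2 =
  qpoch x (x ^+ 2) k / qpoch (x ^+ 2) (x ^+ 2) k.
Proof.
move=> nz nz'; have := qbinom_qpoch x k k.
rewrite addnn -mul2n qpoch_even => e.
have e' : qbinom x (2 * k) k * qpoch x x k = qpoch x (x ^+ 2) k * qpoch (- x) x k.
  by apply: (mulIf nz); rewrite -mulrA e qpoch_sqr; ring.
have -> : qbinom x (2 * k) k = qpoch x (x ^+ 2) k * qpoch (- x) x k / qpoch x x k.
  by rewrite -e' mulfK.
by rewrite qpoch_sqr; field; rewrite nz nz'.
Qed.

Lemma prim_sub1_neq0 (R : nzRingType) (x : R) d j : d.-primitive_root x ->
  ~~ (d %| j)%N -> 1 - x ^+ j != 0.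
Proof. by move=> xp; rewrite (prim_order_dvd xp) subr_eq0 eq_sym. Qed.

(** An instance of the $q$-Vandermonde identity: at a primitive $d$-th root of
    unity all the binomials with upper index $d$ except the two outer ones
    vanish, by [qbinom_qpoch]. The general case follows from the case $n = 0$ by
    Pascal's rule, since the weights $x^m$ have period $d$ in $m$. *)
Lemma qbinom_addn_order (F : fieldType) (x : F) d n m : d.-primitive_root x ->
  qbinom x (n + d) m = qbinom x n m + (if (d <= m)%N then qbinom x n (m - d) else 0).
Proof.
move=> xp; have d0 := prim_order_gt0 xp; have xd := prim_expr_order xp.
elim: n m => [|n IH] m.
  case: m => [|m]; first by rewrite !qbinom0 leqNgt d0 addr0.
  rewrite add0n /= add0r; case: ltngtP => [md|dm|->]; last by rewrite qbinomn subnn.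
    by rewrite qbinom_small //; case E: (m.+1 - d)%N => //; lia.
  have qd : qpoch x x d = 0.
    by rewrite -(prednK d0) qpochS -exprS prednK // xd subrr mulr0.
  have nz i : (i < d)%N -> qpoch x x i != 0.
    move=> id; apply: qpoch_neq0 => j ji; rewrite -exprS.
    apply: (prim_sub1_neq0 xp); rewrite gtnNdvd //; lia.
  have := qbinom_qpoch x (d - m.+1) m.+1.
  rewrite subnK 1?ltnW // qd => /eqP; rewrite !mulf_eq0 => /orP[/eqP //|].
  by rewrite !(negPf (nz _ _)) //; lia.
case: m => [|m]; first by rewrite !qbinom0 leqNgt d0 addr0.
rewrite addSn !qbinomS !IH; case: (ltngtP d m.+1) => [dm|md|dm].
- rewrite -ltnS dm subSn -1?ltnS // qbinomS.
  have -> : x ^+ (m - d).+1 = x ^+ m.+1.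
    by rewrite -[in RHS](@subnK d m.+1) 1?ltnW // exprD xd mulr1 subSn -1?ltnS.
  ring.
- by rewrite leqNgt (ltn_trans _ md) //=; ring.
by rewrite -dm leqNgt dm ltnSn /= subnn !qbinom0 -dm xd; ring.
Qed.

Lemma qbinom_lucas (F : fieldType) (x : F) d a b r s : d.-primitive_root x ->
  (r < d)%N -> (s < d)%N ->
  qbinom x (a * d + r) (b * d + s) = 'C(a, b)%:R * qbinom x r s.
Proof.
move=> xp rd sd; elim: a b => [|a IH] [|b].
- by rewrite bin0 mul1r.
- by rewrite bin0n mul0r qbinom_small // mulSn; lia.
- have := IH 0; rewrite !bin0 => <-.
  by rewrite mulSnr addnAC (qbinom_addn_order _ _ xp) leqNgt sd addr0.
rewrite mulSnr addnAC (qbinom_addn_order _ _ xp) IH mulSn -addnA leq_addr addKn IH.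
by rewrite binS natrD; ring.
Qed.

(** * The summand as a fraction without poles at roots of unity of odd order *)

(** Numerator and denominator of the summand after the simplification by
    [central_qbinom]. They are defined over any ring, so as to be used as
    polynomials, as rational functions and as values at a root of unity. *)
Definition snum (R : comNzRingType) (q : R) (k : nat) : R :=
  qbinom (q ^+ 2) (2 * k) k * qpoch (- q) (q ^+ 2) k ^+ 2 *
  (\sum_(i < 6 * k + 1) q ^+ i) * q ^+ (k ^ 2).

Definition sden (R : comNzRingType) (q : R) (k : nat) : R :=
  qpoch (- q ^+ 2) (q ^+ 2) k ^+ 2 * qpoch (- q ^+ 4) (q ^+ 4) k ^+ 2.

Lemma rmorph_snum (R S : comNzRingType) (f : {rmorphism R -> S}) (q : R) k :
  f (snum q k) = snum (f q) k.
Proof.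
rewrite /snum !rmorphM rmorph_qbinom !rmorphXn rmorph_qpoch rmorphN rmorphXn rmorph_sum.
by congr (_ * _ * _); apply: eq_bigr => i _; rewrite rmorphXn.
Qed.

Lemma rmorph_sden (R S : comNzRingType) (f : {rmorphism R -> S}) (q : R) k :
  f (sden q k) = sden (f q) k.
Proof. by rewrite /sden rmorphM !rmorphXn !rmorph_qpoch !rmorphN !rmorphXn. Qed.

Lemma snum_divr_sden (F : fieldType) (q : F) k :
  q != 1 -> qpoch (q ^+ 2) (q ^+ 2) k != 0 -> qpoch (- q ^+ 2) (q ^+ 2) k != 0 ->
  snum q k / sden q k =
  qpoch (q ^+ 2) (q ^+ 4) k * qpoch (- q) (q ^+ 2) k ^+ 2
  / (qpoch (q ^+ 4) (q ^+ 4) k * qpoch (- q ^+ 4) (q ^+ 4) k ^+ 2)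
  * ((1 - q ^+ (6 * k + 1)) / (1 - q)) * q ^+ (k ^ 2).
Proof.
move=> q1 nz nz'; have := central_qbinom nz nz'.
rewrite (_ : q ^+ 2 ^+ 2 = q ^+ 4) -?exprM // => cq.
have -> : (1 - q ^+ (6 * k + 1)) / (1 - q) = \sum_(i < 6 * k + 1) q ^+ i.
  rewrite -opprB subrX1 -mulNr opprB mulrAC mulfV ?mul1r //.
  by rewrite subr_eq0 eq_sym.
rewrite /snum /sden -[X in _ = X * _ * _]mulf_div -cq.
have -> x y z t u v : x * y * z * t / (u * v) = (x / u) * (y / v) * z * t :> F.
  by rewrite invfM; ring.
by [].
Qed.

Lemma one_add_unity_root_neq0 (F : fieldType) (q : F) d j :
  2%:R != 0 :> F -> odd d -> q ^+ d = 1 -> 1 + q ^+ j != 0.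
Proof.
move=> two od qd; apply/eqP => e.
have {}e : q ^+ j = -1 by apply/eqP; rewrite -addr_eq0 addrC e.
have : (-1) ^+ d = 1 :> F by rewrite -e -exprM mulnC exprM qd expr1n.
move/eqP; rewrite -signr_odd od expr1 -subr_eq0 -opprD oppr_eq0.
by apply/negP.
Qed.

Lemma sden_neq0 (F : fieldType) (q : F) d k :
  2%:R != 0 :> F -> odd d -> q ^+ d = 1 -> sden q k != 0.
Proof.
move=> two od qd; rewrite mulf_neq0 // expf_neq0 // qpoch_neq0 // => j _.
  by rewrite mulNr opprK -!exprM -exprD (one_add_unity_root_neq0 _ two od).
by rewrite mulNr opprK -!exprM -exprD (one_add_unity_root_neq0 _ two od).
Qed.

(** * Vanishing of the sums at roots of unity *)

(** This is [cleared_sum_root_of_unity] at $a = q$ and $b = -q$, where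
    $a/b \cdot q^{4j+4} = abq^{4j+2} = -q^{4j+4}$ and $q^2/b = b$, divided by
    $(1-q)(-q^4;q^4)_m^2$. *)
Lemma sum_half_period (F : fieldType) (q : F) m :
  2%:R != 0 :> F -> (0 < m)%N -> (2 * m + 1).-primitive_root q ->
  \sum_(0 <= k < m.+1) snum q k / sden q k = 0.
Proof.
move=> two m0 qp; have qd := prim_expr_order qp.
set d := (2 * m + 1)%N in qp qd.
have od : odd d by rewrite /d oddD oddM.
have sub_nz j : ~~ (d %| j)%N -> 1 - q ^+ j != 0 by apply: prim_sub1_neq0.
have add_nz j : 1 + q ^+ j != 0 by apply: (one_add_unity_root_neq0 j two od).
have q0 : q != 0.
  apply/eqP => e; move/eqP: qd; rewrite e expr0n /d addn1 /= eq_sym.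
  by rewrite oner_eq0.
have c4 : coprime d 4 by rewrite -[4%N]/(2 ^ 2)%N coprimeXr // coprimen2.
have nz4 k : (k <= m)%N -> 1 - q ^+ (4 * k + 4) != 0.
  move=> km; apply: sub_nz; rewrite -mulnSr Gauss_dvdr // gtnNdvd //.
  by rewrite /d; lia.
pose U k := qpoch (- q) (q ^+ 2) k * qpoch (q ^+ 2 / - q) (q ^+ 2) k *
  qpoch (q ^+ 2) (q ^+ 4) k / qpoch (q ^+ 4) (q ^+ 4) k * q ^+ (k * k.-1).
have qN0 : - q != 0 by rewrite oppr_eq0.
have U0 : U 0 = 1 by rewrite /U !qpoch0 muln0 expr0 invr1 !mulr1.
have UE k : (k <= m)%N -> (1 - q ^+ (4 * k + 4)) * U k.+1 =
     (1 - - q * q ^+ (2 * k)) * (1 - (- q)^-1 * q ^+ (2 * k + 2)) *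
     (1 - q ^+ (4 * k + 2)) * q ^+ (2 * k) * U k.
  move=> km; have := nz4 k km; rewrite /U !qpochS.
  have -> : (k.+1 * k.+1.-1 = k * k.-1 + 2 * k)%N by case: k {km} => //= k; lia.
  have -> : (4 * k = 2 * k * 2)%N by lia.
  rewrite -!(exprM q 2 k) -(exprM q 4 k).
  have -> : (4 * k = 2 * k * 2)%N by lia.
  rewrite !(exprD q (2 * k)) !(exprD q (2 * k * 2)) (exprD q (k * k.-1)).
  rewrite !(exprM q (2 * k)) [q ^+ 4 * _]mulrC.
    rewrite [(qpoch (q ^+ 4) _ _ * _)^-1]invfM.
  move: (qpoch (q ^+ 4) _ _)^-1 (q ^+ (2 * k)) => D K nz.
  by field; rewrite qN0 nz.
have q1 : q != 1.
  by rewrite eq_sym -subr_eq0 -[q]expr1; apply: sub_nz; rewrite dvdn1 /d; lia.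
have nz2 k : (k <= m)%N -> qpoch (q ^+ 2) (q ^+ 2) k != 0.
  move=> km; apply: qpoch_neq0 => j jk; rewrite -exprM -exprD; apply: sub_nz.
  rewrite -mulnS Gauss_dvdr ?coprimen2 // gtnNdvd //.
  by rewrite /d; lia.
have nz2' k : qpoch (- q ^+ 2) (q ^+ 2) k != 0.
  by apply: qpoch_neq0 => j jk; rewrite mulNr opprK -exprM -exprD.
have nzV k : qpoch (- q ^+ 4) (q ^+ 4) k != 0.
  by apply: qpoch_neq0 => j jk; rewrite mulNr opprK -exprM -exprD.
have := cleared_sum_root_of_unity qp qN0 U0 UE q.
rewrite qd subrr /cleared_sum => S0.
have nzC : (1 - q) * qpoch (- q ^+ 4) (q ^+ 4) m ^+ 2 != 0.
  by rewrite mulf_neq0 ?expf_neq0 // subr_eq0 eq_sym.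
apply: (mulfI nzC); rewrite mulr0 -[RHS]S0 mulr_sumr.
apply: eq_big_nat => k /andP[_ km].
have tail : qpoch (- q ^+ 4) (q ^+ 4) m ^+ 2 = qpoch (- q ^+ 4) (q ^+ 4) k ^+ 2 *
    \prod_(k <= j < m) ((1 - q * (- q)^-1 * q ^+ (4 * j + 4)) *
                        (1 - q * - q * q ^+ (4 * j + 2))).
  have wE j : (1 - q * (- q)^-1 * q ^+ (4 * j + 4)) * (1 - q * - q * q ^+ (4 * j + 2)) =
      (1 - - q ^+ 4 * q ^+ 4 ^+ j) ^+ 2.
    by rewrite !(exprD q (4 * j)) -(exprM q 4 j); field; rewrite qN0.
  under eq_bigr => j _ do rewrite wE.
  rewrite prodrXl -exprMn; congr (_ ^+ 2).
  rewrite /qpoch -!(big_mkord xpredT (fun j => 1 - - q ^+ 4 * q ^+ 4 ^+ j)).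
  by rewrite -big_cat_nat.
rewrite snum_divr_sden ?nz2 // tail.
rewrite /U.
have -> : q ^+ 2 / - q = - q by field; rewrite qN0.
have -> : (k ^ 2 = k + k * k.-1)%N by case: k {km tail} => //= k; lia.
rewrite (exprD q k) addn1 (exprS q (6 * k)).
move: (\prod_(_ <= _ < _) _) => W.
have nz4' : qpoch (q ^+ 4) (q ^+ 4) k != 0.
  by apply: qpoch_neq0 => j jk; rewrite -exprM -exprD addnC nz4 //; lia.
by field; rewrite nz4' nzV subr_eq0 eq_sym q1.
Qed.

(** For $2k < d$ the quotient and the remainder of $2(ld+k)$ by $d$ are $2l$ and
    $2k$. Otherwise a carry makes the remainder $2k-d < k$, and both sides
    vanish. *)
Lemma snum_periodic (F : fieldType) (q : F) d l k :
  odd d -> (1 < d)%N -> d.-primitive_root q -> (k < d)%N ->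
  snum q (l * d + k) =
  'C(2 * l, l)%:R * qpoch (- q) (q ^+ 2) d ^+ (2 * l) * snum q k.
Proof.
move=> od d1 qp kd; have qd := prim_expr_order qp.
have q2p : d.-primitive_root (q ^+ 2) by rewrite prim_root_exp_coprime ?coprime2n.
have q1 : q - 1 != 0.
  by rewrite -opprB oppr_eq0 -[q]expr1 (prim_sub1_neq0 qp) // gtnNdvd.
have qX i : q ^+ (l * d * i) = 1.
  by rewrite mulnAC mulnC exprM qd expr1n.
rewrite /snum.
have -> : q ^+ ((l * d + k) ^ 2) = q ^+ (k ^ 2).
  have -> : ((l * d + k) ^ 2 = l * d * (l * d + 2 * k) + k ^ 2)%N by lia.
  by rewrite exprD qX mul1r.
have -> : \sum_(i < 6 * (l * d + k) + 1) q ^+ i = \sum_(i < 6 * k + 1) q ^+ i.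
  apply: (mulfI q1); rewrite -!subrX1.
  have -> : (6 * (l * d + k) + 1 = l * d * 6 + (6 * k + 1))%N by lia.
  by rewrite exprD qX mul1r.
rewrite (qpoch_periodic _ _ _ (prim_expr_order q2p)).
suff -> : qbinom (q ^+ 2) (2 * (l * d + k)) (l * d + k) =
    'C(2 * l, l)%:R * qbinom (q ^+ 2) (2 * k) k.
  by rewrite mulnC exprM; ring.
have [lt|ge] := ltnP (2 * k) d.
  by rewrite mulnDr mulnA (qbinom_lucas _ _ q2p).
have kd' : (2 * k - d < d)%N by lia.
have -> : (2 * (l * d + k) = (2 * l + 1) * d + (2 * k - d))%N by lia.
rewrite (qbinom_lucas _ _ q2p) // (@qbinom_small _ _ (2 * k - d)) ?mulr0; last by lia.
have := qbinom_lucas 1 0 q2p kd' kd.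
rewrite mul1n mul0n add0n subnKC // => ->.
by rewrite (@qbinom_small _ _ (2 * k - d)) ?mulr0 //; lia.
Qed.

Lemma sden_periodic (F : fieldType) (q : F) d l k : q ^+ d = 1 ->
  sden q (l * d + k) = sden q d ^+ l * sden q k.
Proof.
move=> qd; have qX i : q ^+ i ^+ d = 1 by rewrite -exprM mulnC exprM qd expr1n.
have sqr_mul A a B b : (A ^+ l * a) ^+ 2 * (B ^+ l * b) ^+ 2 =
    (A ^+ 2 * B ^+ 2) ^+ l * (a ^+ 2 * b ^+ 2) :> F.
  rewrite (exprMn 2 _ a) (exprMn 2 _ b) (exprMn l (A ^+ 2)) !(exprAC _ l 2).
  exact: mulrACA.
by rewrite /sden !qpoch_periodic.
Qed.

(** Block number $l$ is the first block multiplied by a constant; this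
    holds also for an initial segment of a block, which gives the last,
    incomplete one. *)
Lemma sum_periods (F : fieldType) (q : F) d s e :
  odd d -> (1 < d)%N -> d.-primitive_root q -> (e <= d)%N ->
  \sum_(0 <= k < d) snum q k / sden q k = 0 ->
  \sum_(0 <= k < e) snum q k / sden q k = 0 ->
  \sum_(0 <= k < s * d + e) snum q k / sden q k = 0.
Proof.
move=> od d1 qp ed Sd Se.
have block l f : (f <= d)%N -> \sum_(0 <= k < f) snum q k / sden q k = 0 ->
    \sum_(l * d <= k < l * d + f) snum q k / sden q k = 0.
  move=> fd Sf; rewrite -{1}[(l * d)%N]add0n big_addn addKn.
  transitivity ('C(2 * l, l)%:R * qpoch (- q) (q ^+ 2) d ^+ (2 * l) /
      sden q d ^+ l * \sum_(0 <= k < f) snum q k / sden q k); last by rewrite Sf mulr0.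
  rewrite mulr_sumr; apply: eq_big_nat => k /andP[_ kf].
  rewrite addnC snum_periodic ?(leq_trans kf) // sden_periodic ?(prim_expr_order qp) //.
  by rewrite invfM; ring.
rewrite (big_cat_nat (n := s * d)) ?leq_addr //= block // addr0.
elim: s => [|s IH]; first by rewrite mul0n big_geq.
by rewrite mulSnr (big_cat_nat (n := s * d)) ?leq_addr //= IH add0r block.
Qed.

(** The carry in $2k = d + (2k-d)$, with $2k - d < k$, makes the $q$-binomial
    vanish. *)
Lemma snum_eq0 (F : fieldType) (q : F) d k :
  odd d -> d.-primitive_root q -> (d <= 2 * k)%N -> (k < d)%N -> snum q k = 0.
Proof.
move=> od qp dk kd.
have q2p : d.-primitive_root (q ^+ 2) by rewrite prim_root_exp_coprime ?coprime2n.
have lt : (2 * k - d < d)%N by lia.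
have := qbinom_lucas 1 0 q2p lt kd.
rewrite mul1n mul0n add0n subnKC // /snum => ->.
by rewrite (@qbinom_small _ _ (2 * k - d)) ?mulr0 ?mul0r //; lia.
Qed.

(** With $n = rd$ and $d = 2m+1$, the range $0 \le k \le (n-1)/2$ consists of
    $(r-1)/2$ full blocks of length $d$ and of the first half $0 \le k \le m$ of
    another one. *)
Lemma sums_at_unity_root (F : fieldType) (q : F) n :
  2%:R != 0 :> F -> odd n -> q ^+ n = 1 -> q != 1 ->
  \sum_(0 <= k < n) snum q k / sden q k = 0 /\
  \sum_(0 <= k < ((n - 1) %/ 2).+1) snum q k / sden q k = 0.
Proof.
move=> two on qn q1.
have n0 : (0 < n)%N by case: n on {qn}.
have [d qp dn] := prim_order_exists n0 qn.
have od : odd d by apply: dvdn_odd dn on.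
have d0 := prim_order_gt0 qp.
have d1 : (1 < d)%N.
  rewrite ltn_neqAle d0 andbT; apply: contraNneq q1 => e.
  by rewrite -[q]expr1 e (prim_expr_order qp).
pose m := d./2; have dE : d = (2 * m + 1)%N by rewrite /m; lia.
have half : \sum_(0 <= k < m.+1) snum q k / sden q k = 0.
  by apply: sum_half_period => //; [lia | rewrite -dE].
have full : \sum_(0 <= k < d) snum q k / sden q k = 0.
  rewrite (big_cat_nat (n := m.+1)) //=; last by lia.
  rewrite half add0r big_nat big1 // => k /andP[mk kd].
  by rewrite (snum_eq0 od qp) ?mul0r //; lia.
have [r nE] := dvdnP dn.
have or : odd r by move: on; rewrite nE oddM => /andP[].
split.
  by rewrite nE -[(r * d)%N]addn0; apply: sum_periods => //; rewrite big_geq.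
have -> : (((n - 1) %/ 2).+1 = r./2 * d + m.+1)%N by nia.
by apply: sum_periods => //; lia.
Qed.

(** * From rational functions to values at roots of unity *)

Definition common_den (K : nat) : {poly int} := \prod_(0 <= k < K) sden 'X k.

Definition common_num (K : nat) : {poly int} :=
  \sum_(0 <= k < K) snum 'X k * \prod_(0 <= j < K | j != k) sden 'X j.

(** Used twice: for the embedding of $\mathbb Z[q]$ into its fraction field, and
    for the evaluation at a root of unity. *)
Lemma common_fraction (F : fieldType) (f : {rmorphism {poly int} -> F}) K :
  (forall k, sden (f 'X) k != 0) ->
  \sum_(0 <= k < K) snum (f 'X) k / sden (f 'X) k =
  f (common_num K) / f (common_den K).
Proof.
move=> nz; rewrite /common_num rmorph_sum mulr_suml; apply: eq_big_nat => k /andP[_ kK].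
rewrite /common_den (bigD1_seq k) ?iota_uniq ?mem_index_iota //=.
rewrite (rmorphM f (snum _ _)) (rmorphM f (sden _ _)) rmorph_snum rmorph_sden.
rewrite -mulf_div divff ?mulr1 // rmorph_prod.
by rewrite prodf_seq_neq0; apply/allP => j _; rewrite rmorph_sden nz implybT.
Qed.

Lemma common_den_map_neq0 (F : fieldType) (f : {rmorphism {poly int} -> F}) K :
  (forall k, sden (f 'X) k != 0) -> f (common_den K) != 0.
Proof.
by move=> nz; rewrite rmorph_prod prodf_seq_neq0; apply/allP => j _; rewrite rmorph_sden nz.
Qed.

Lemma qvarX_neq (c : int) j : (0 < j)%N -> qvar ^+ j != (c%:P)%:F.
Proof.
move=> j0; rewrite /qvar -tofracXn tofrac_eq; apply/eqP => /(congr1 (size : {poly int} -> nat)).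
by rewrite size_polyXn => e; have := size_polyC_leq1 c; rewrite -e ltnS leqNgt j0.
Qed.

Lemma one_sub_qvarX_neq0 j : (0 < j)%N -> 1 - qvar ^+ j != 0.
Proof. by move/(qvarX_neq 1); rewrite polyC1 tofrac1 subr_eq0 eq_sym. Qed.

Lemma one_add_qvarX_neq0 j : (0 < j)%N -> 1 + qvar ^+ j != 0.
Proof.
by move/(qvarX_neq (-1)); rewrite polyCN polyC1 tofracN tofrac1 addrC addr_eq0.
Qed.

Lemma sden_qvar_neq0 k : sden qvar k != 0.
Proof.
rewrite mulf_neq0 // expf_neq0 // qpoch_neq0 // => j _;
  by rewrite mulNr opprK -exprM -exprD one_add_qvarX_neq0.
Qed.

Lemma summandE k : summand k = snum qvar k / sden qvar k.
Proof.
rewrite snum_divr_sden //.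
- by rewrite eq_sym -subr_eq0 -[qvar]expr1 one_sub_qvarX_neq0.
- by apply: qpoch_neq0 => j _; rewrite -exprM -exprD one_sub_qvarX_neq0.
by apply: qpoch_neq0 => j _; rewrite mulNr opprK -exprM -exprD one_add_qvarX_neq0.
Qed.

Lemma sum_summand K :
  \sum_(0 <= k < K) summand k = (common_num K)%:F / (common_den K)%:F.
Proof.
rewrite -(@common_fraction _ (@tofrac {poly int})); last exact: sden_qvar_neq0.
by apply: eq_bigr => k _; rewrite summandE.
Qed.

(** * Divisibility by and coprimality with [n] *)

Definition evalC (x : algC) : {rmorphism {poly int} -> algC} :=
  (horner_eval x \o map_poly (intr : int -> algC)).

Lemma evalCE x p : evalC x p = (map_poly intr p).[x].
Proof. by []. Qed.

Lemma evalCX x : evalC x 'X = x.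
Proof. by rewrite evalCE map_polyX hornerX. Qed.

Lemma evalC_qint_poly x n : evalC x (qint_poly n) = \sum_(i < n) x ^+ i.
Proof. by rewrite rmorph_sum; apply: eq_bigr => i _; rewrite rmorphXn evalCX. Qed.

Lemma qint_poly_root (x : algC) n : (0 < n)%N ->
  (evalC x (qint_poly n) == 0) = (x ^+ n == 1) && (x != 1).
Proof.
move=> n0; rewrite evalC_qint_poly; have [->|x1] := eqVneq x 1.
  rewrite andbF (eq_bigr (fun=> 1)) => [|i _]; last by rewrite expr1n.
  by rewrite sumr_const card_ord Num.Theory.pnatr_eq0; case: n n0.
by rewrite andbT -(subr_eq0 _ 1) subrX1 mulf_eq0 subr_eq0 (negPf x1).
Qed.

Lemma qint_polyS n : qint_poly n.+1 = \poly_(i < n.+1) 1.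
Proof. by rewrite poly_def; apply: eq_bigr => i _; rewrite scale1r. Qed.

Lemma size_qint_poly n : size (qint_poly n) = n.
Proof.
by case: n => [|n]; [rewrite /qint_poly big_ord0 size_poly0 | rewrite qint_polyS size_poly_eq].
Qed.

Lemma monic_qint_poly n : (0 < n)%N -> qint_poly n \is monic.
Proof.
case: n => // n _.
by rewrite monicE lead_coefE size_qint_poly qint_polyS coef_poly ltnSn.
Qed.

(** The remainder of the division by the monic $[n]$ has integer coefficients
    and degree less than $n-1$, but it vanishes at the $n-1$ powers
    $z, \dots, z^{n-1}$ of a primitive $n$-th root of unity. *)
Lemma qint_poly_dvd n (p : {poly int}) : (0 < n)%N ->
  (forall x : algC, x ^+ n = 1 -> x != 1 -> evalC x p = 0) -> Zq_dvd (qint_poly n) p.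
Proof.
move=> n0 pn; pose r := Pdiv.Ring.rmodp p (qint_poly n).
have pE := Pdiv.RingMonic.rdivp_eq (monic_qint_poly n0) p.
exists (Pdiv.Ring.rdivp p (qint_poly n)).
suff r0 : r = 0 by rewrite [LHS]pE -/r r0 addr0.
have sr : (size r < n)%N.
  by rewrite -[ltnRHS](size_qint_poly n) Pdiv.Ring.ltn_rmodpN0 // monic_neq0 ?monic_qint_poly.
have root_r x : x ^+ n = 1 -> x != 1 -> root (map_poly (intr : int -> algC) r) x.
  move=> xn x1; apply/rootP; rewrite -[LHS]/(evalC x r).
  have := pn x xn x1; rewrite pE rmorphD rmorphM.
  have /eqP -> : evalC x (qint_poly n) == 0 by rewrite qint_poly_root // xn eqxx.
  by rewrite mulr0 add0r.
have szr : size (map_poly (intr : int -> algC) r) = size r.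
  by rewrite size_map_inj_poly //; exact: intr_inj.
have [z zp] := C_prim_root_exists n0.
apply/eqP; rewrite -size_poly_eq0 -szr size_poly_eq0; apply: contraTT sr => rC0.
have mem_lt i : i \in iota 1 n.-1 -> (0 < i < n)%N.
  by rewrite mem_iota add1n prednK.
rewrite -leqNgt -(prednK n0) -(size_iota 1 n.-1) -(size_map (GRing.exp z)) -szr.
apply: max_poly_roots => //.
  apply/allP => _ /mapP[i /mem_lt/andP[i0 lin] ->]; apply: root_r.
    by rewrite -exprM mulnC exprM (prim_expr_order zp) expr1n.
  by rewrite -(prim_order_dvd zp) gtnNdvd.
rewrite map_inj_in_uniq ?iota_uniq // => i j /mem_lt/andP[_ il] /mem_lt/andP[_ jl].
by move/eqP; rewrite (eq_prim_root_expr zp) !modn_small // => /eqP.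
Qed.

(** A common divisor has leading coefficient $\pm 1$ because $[n]$ is monic. If
    it is not constant, it has a complex root, which is also a root of
    $[n]$ and [p]. *)
Lemma qint_poly_coprime n (p : {poly int}) : (0 < n)%N ->
  (forall x : algC, x ^+ n = 1 -> x != 1 -> evalC x p != 0) -> Zq_coprime (qint_poly n) p.
Proof.
move=> n0 pn D [C nE] [E pE].
have lu : lead_coef D \is a GRing.unit.
  have := congr1 lead_coef nE; rewrite lead_coefM (monicP (monic_qint_poly n0)) => e.
  by apply/unitrPr; exists (lead_coef C); rewrite mulrC.
have D0 : D != 0 by rewrite -lead_coef_eq0; apply: contraTneq lu => ->; rewrite unitr0.
have [s1|s1] := eqVneq (size D) 1.
  have [c c0 Dc] := size_poly1P _ (introT eqP s1).
  by move: lu; rewrite Dc lead_coefC poly_unitE size_polyC c0 coefC.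
have szD : size (map_poly (intr : int -> algC) D) = size D.
  by rewrite size_map_inj_poly //; exact: intr_inj.
have /closed_rootP[x /rootP] : size (map_poly (intr : int -> algC) D) != 1 by rewrite szD.
rewrite -[LHS]/(evalC x D) => xD.
have : evalC x (qint_poly n) == 0 by rewrite nE rmorphM xD mulr0.
rewrite qint_poly_root // => /andP[/eqP xn x1].
by have := pn x xn x1; rewrite pE rmorphM xD mulr0 eqxx.
Qed.

Theorem theorem1p3 (n : nat) (n_gt0 : (0 < n)%N) (n_odd : odd n) :
  ratfun_congr (\sum_(0 <= k < n) summand k) 0 (qint_poly n) /\
  ratfun_congr (\sum_(0 <= k < ((n - 1) %/ 2).+1) summand k) 0 (qint_poly n).
Proof.
have two : 2%:R != 0 :> algC by rewrite Num.Theory.pnatr_eq0.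
have den_nz (x : algC) : x ^+ n = 1 -> forall k, sden (evalC x 'X) k != 0.
  by move=> xn k; rewrite evalCX (sden_neq0 _ two n_odd xn).
have congr0 K : (forall x : algC, x ^+ n = 1 -> x != 1 ->
      \sum_(0 <= k < K) snum x k / sden x k = 0) ->
    ratfun_congr (\sum_(0 <= k < K) summand k) 0 (qint_poly n).
  move=> S0; exists (common_num K), (common_den K); split.
  - have := @common_den_map_neq0 _ (@tofrac {poly int}) K sden_qvar_neq0.
    by apply: contraNneq => ->; rewrite rmorph0.
  - by rewrite subr0 sum_summand.
  - apply: qint_poly_dvd => // x xn x1; have nz := den_nz x xn.
    have := common_fraction K nz; rewrite evalCX S0 // => /esym/eqP.
    by rewrite mulf_eq0 invr_eq0 (negPf (common_den_map_neq0 K nz)) orbF => /eqP.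
  - by apply: qint_poly_coprime => // x xn x1; apply/common_den_map_neq0/den_nz.
by split; apply: congr0 => x xn x1; have [] := sums_at_unity_root two n_odd xn x1.
Qed.
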